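(* Let $\bar{\boldsymbol{x}}\in\hat{\mathcal{X}}$ be a local minimizer of the problem $\min\{f(\boldsymbol{x}):\boldsymbol{x}\in\hat{\mathcal{X}}\}$. Then there exist $\bar{\boldsymbol{y}}\in\mathbb{R}^S_+$ and $\bar{\boldsymbol{z}}\in\mathcal{C}$ such that $(\bar{\boldsymbol{x}},\bar{\boldsymbol{y}},\bar{\boldsymbol{z}})\in\Omega$ is a local minimizer of the problem $\min\{f(\boldsymbol{x}):(\boldsymbol{x},\boldsymbol{y},\boldsymbol{z})\in\Omega\}$.
   Context: $[n]=\{1,\dots,n\}$. Let $S,I$ be positive integers, $\alpha\in(0,1)$, $m=\lfloor\alpha S\rfloor$. Standing assumptions: $\mathcal{X}\subseteq\mathbb{R}^d$ is compact, convex, with nonempty relative interior, contained in an open set $\mathcal{U}\subseteq\mathbb{R}^d$; $f:\mathcal{U}\to\mathbb{R}$ is continuously differentiable and convex; for each $s\in[S]$ (scenario), $g_s(\boldsymbol{x})=\max_{i\in[I]}h_{s,i}(\boldsymbol{x})$ where each $h_{s,i}:\mathbb{R}^d\to\mathbb{R}$ is continuously differentiable and convex. Let $g_{(1)}(\boldsymbol{x})\le\cdots\le g_{(S)}(\boldsymbol{x})$ be the nondecreasing rearrangement of $(g_1(\boldsymbol{x}),\dots,g_S(\boldsymbol{x}))$, $G_1(\boldsymbol{x})=\sum_{s=S-m}^{S}g_{(s)}(\boldsymbol{x})$, $G_2(\boldsymbol{x})=\sum_{s=S-m+1}^{S}g_{(s)}(\boldsymbol{x})$, $\phi=G_1-G_2$,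 and $\hat{\mathcal{X}}=\{\boldsymbol{x}\in\mathcal{X}:\phi(\boldsymbol{x})\le0\}$. $\mathcal{C}=\{\boldsymbol{z}\in\mathbb{R}^S:0\le z_s\le1\ \forall s\in[S],\ \sum_{s=1}^S z_s\ge S-m\}$, and $$\Omega=\{(\boldsymbol{x},\boldsymbol{y},\boldsymbol{z})\in\mathcal{X}\times\mathbb{R}^S_+\times\mathcal{C}:\ g_s(\boldsymbol{x})\le y_s,\ y_sz_s=0\ \ \forall s\in[S]\}.$$ Local minimizers are with respect to the Euclidean norm on $\mathbb{R}^d$ and on $\mathbb{R}^d\times\mathbb{R}^S\times\mathbb{R}^S$, respectively. *)

(* Defs.v *)
From mathcomp Require Import all_boot all_order all_algebra.
From mathcomp Require Import all_classical all_reals all_analysis.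

Set Implicit Arguments.
Unset Strict Implicit.
Unset Printing Implicit Defensive.

Import Order.TTheory GRing.Theory Num.Theory.
Import numFieldNormedType.Exports.

Local Open Scope classical_set_scope.
Local Open Scope ring_scope.

(* The library norm on 'rV[R]_n is the sup norm; it induces the same topology
   as the Euclidean norm, so the library's [open], [compact], [differentiable]
   and [nbhs] are used as they are, and [enorm] only serves to state local
   minimality. *)
Definition enorm (R : realType) (n : nat) (v : 'rV[R]_n) : R :=
  Num.sqrt (\sum_(j < n) v 0 j ^+ 2).

Definition enorm3 (R : realType) (d n k : nat)
    (p : 'rV[R]_d * 'rV[R]_n * 'rV[R]_k) : R :=
  Num.sqrt (enorm p.1.1 ^+ 2 + enorm p.1.2 ^+ 2 + enorm p.2 ^+ 2).

Definition local_minimizer (R : realType) (T : zmodType) (N : T -> R)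
    (A : set T) (F : T -> R) (a : T) : Prop :=
  A a /\
  exists2 e : R, 0 < e & forall p : T, A p -> N (p - a) < e -> F a <= F p.

Definition affine_hull (R : realType) (d : nat) (A : set 'rV[R]_d) :
    set 'rV[R]_d :=
  [set x | exists n (c : 'I_n -> R) (a : 'I_n -> 'rV[R]_d),
     [/\ forall i, A (a i), \sum_(i < n) c i = 1 &
         x = \sum_(i < n) c i *: a i]].

Definition relative_interior (R : realType) (d : nat) (A : set 'rV[R]_d) :
    set 'rV[R]_d :=
  [set x | A x /\ within (affine_hull A) (nbhs x) A].

Definition gradient (R : realType) (d : nat) (f : 'rV[R]_d -> R)
    (x : 'rV[R]_d) : 'rV[R]_d :=
  \row_(j < d) 'D_(delta_mx 0 j) f x.

(* A function defined on an open set U is represented by a total function.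
   This predicate and the next one constrain it on U only. *)
Definition continuously_differentiable_on (R : realType) (d : nat)
    (U : set 'rV[R]_d) (f : 'rV[R]_d -> R) : Prop :=
  (forall x, U x -> differentiable f x) /\ {within U, continuous (gradient f)}.

(* U is not assumed convex, so convexity of f on U is understood on every
   convex subset of U; this is [convex_function U f] when U is convex. *)
Definition convex_on (R : realType) (d : nat)
    (U : set 'rV[R]_d) (f : 'rV[R]_d -> R) : Prop :=
  forall K : set 'rV[R]_d, convex_set K -> K `<=` U -> convex_function K f.

(* max_{i in [I]} h_{s,i}(x); the initial value of the iterated maximum is one
   of the terms. *)
Definition scenario_max (R : realType) (d S I : nat) (I_gt0 : (0 < I)%N)
    (h : 'I_S -> 'I_I -> 'rV[R]_d -> R) (s : 'I_S) (x : 'rV[R]_d) : R :=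
  \big[Num.max/h s (Ordinal I_gt0) x]_(i < I) h s i x.

(* The k-th smallest of the values a_1, ..., a_S, for 1 <= k <= S. *)
Definition order_stat (R : realType) (S : nat) (a : 'I_S -> R) (k : nat) : R :=
  (sort <=%R [seq a s | s : 'I_S])`_k.-1.

Section Problem.
Variables (R : realType) (d S : nat) (m : nat) (X : set 'rV[R]_d).
Variable g : 'I_S -> 'rV[R]_d -> R.

Definition G1 (x : 'rV[R]_d) : R :=
  \sum_(S - m <= k < S.+1) order_stat (fun s => g s x) k.

Definition G2 (x : 'rV[R]_d) : R :=
  \sum_((S - m).+1 <= k < S.+1) order_stat (fun s => g s x) k.

Definition phi (x : 'rV[R]_d) : R := G1 x - G2 x.

Definition Xhat : set 'rV[R]_d := [set x | X x /\ phi x <= 0].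

Definition nonneg_orthant : set 'rV[R]_S := [set y | forall s, 0 <= y 0 s].

Definition Cset : set 'rV[R]_S :=
  [set z | (forall s, 0 <= z 0 s <= 1) /\
           S%:R - m%:R <= \sum_(s < S) z 0 s].

Definition Omega : set ('rV[R]_d * 'rV[R]_S * 'rV[R]_S) :=
  [set p | let: (x, y, z) := p in
     [/\ X x, nonneg_orthant y, Cset z &
         forall s, g s x <= y 0 s /\ y 0 s * z 0 s = 0]].

End Problem.

Arguments nonneg_orthant {R} S.
Arguments Cset {R} S m.

(* Main.v *)
Require Import Defs.
From mathcomp Require Import all_boot all_order all_algebra.
From mathcomp Require Import all_classical all_reals all_analysis.

Set Implicit Arguments.
Unset Strict Implicit.
Unset Printing Implicit Defensive.

Import Order.TTheory GRing.Theory Num.Theory.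
Import numFieldNormedType.Exports.

Local Open Scope classical_set_scope.
Local Open Scope ring_scope.

(** The lifted problem is the original one in disguise: the projection of
    Omega onto the x-coordinate is exactly Xhat, and the objective depends on
    x alone.

    The point is a counting reformulation of the constraint.  The difference
    of the two tail sums telescopes to the (S - m)-th smallest scenario value
    ([phiE]), and the k-th smallest of finitely many numbers is nonpositive
    precisely when at least k of them are ([order_stat_le]).  Hence x is in
    Xhat exactly when at least S - m scenarios satisfy g_s(x) <= 0.

    If (x, y, z) is in Omega, complementarity forces y_s = 0, hence
    g_s(x) <= 0, wherever z_s > 0; as no z_s exceeds 1 and they add up to at
    least S - m, there are at least S - m such scenarios ([Omega_Xhat]).
    Conversely, y = the positive part of g(x) and z = the indicator of the
    satisfied scenarios lift any x of Xhat to Omega ([Xhat_lift]).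

    Finally, projecting onto x does not increase the Euclidean distance
    ([enorm_le_enorm3]), so every feasible point near a lift of xbar projects
    to a feasible point near xbar, and the same radius witnesses local
    minimality.  Since alpha < 1, m < S, so that S - m is a genuine rank,
    between 1 and S. *)

(** In a sorted sequence the entries at most t form an initial segment, so the
    entry of rank k lies in it exactly when the segment has length at least
    k. *)
Lemma order_stat_le (R : realType) (S : nat) (a : 'I_S -> R) (k : nat) (t : R) :
  (0 < k <= S)%N -> (order_stat a k <= t) = (k <= #|[pred s | (a s <= t)%R]|)%N.
Proof.
move=> /andP[k0 kS].
have -> : #|[pred s | (a s <= t)%R]|%N =
    count (fun y => y <= t) (sort <=%R [seq a s | s : 'I_S]).
  rewrite (permP (permEl (perm_sort _ _))) count_map cardE.
  rewrite /image_mem enumT /enum_mem size_filter.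
  by apply: eq_count => s; rewrite inE.
rewrite /order_stat; set l := sort _ _.
have l_sorted : sorted <=%O l by exact: sort_le_sorted.
have sz : size l = S by rewrite size_sort size_map size_enum_ord.
have [lek|lek] := leqP k (count (fun y => y <= t) l).
  by apply: nth_count_le => //; rewrite prednK.
apply/negbTE; rewrite -ltNge; apply: nth_count_gt => //.
by rewrite sz prednK // kS andbT -ltnS prednK.
Qed.

Lemma phiE (R : realType) (d S m : nat) (g : 'I_S -> 'rV[R]_d -> R)
    (x : 'rV[R]_d) :
  phi m g x = order_stat (fun s => g s x) (S - m).
Proof. by rewrite /phi /G1 /G2 big_ltn ?ltnS ?leq_subr // addrK. Qed.

Lemma XhatP (R : realType) (d S m : nat) (X : set 'rV[R]_d)
    (g : 'I_S -> 'rV[R]_d -> R) (x : 'rV[R]_d) :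
  (m < S)%N ->
  Xhat m X g x <-> X x /\ (S - m <= #|[pred s | (g s x <= 0)%R]|)%N.
Proof.
move=> mS; rewrite /Xhat /= phiE order_stat_le //.
by rewrite subn_gt0 mS leq_subr.
Qed.

(** Since z_s <= 1, and z_s = 0 where g_s(x) > 0, the sum of the z_s is at most
    the number of satisfied scenarios. *)
Lemma Omega_Xhat (R : realType) (d S m : nat) (X : set 'rV[R]_d)
    (g : 'I_S -> 'rV[R]_d -> R) (x : 'rV[R]_d) (y z : 'rV[R]_S) :
  (m < S)%N -> Omega m X g (x, y, z) -> Xhat m X g x.
Proof.
move=> mS [Xx _ [z01 sumz] gyz]; apply/XhatP => //; split => //.
rewrite -(ler_nat R) natrB ?(ltnW mS) //; apply: le_trans sumz _.
rewrite -sum1_card natr_sum [leRHS]big_mkcond /=; apply: ler_sum => s _.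
have [gy yz] := gyz s; have /andP[z0 z1] := z01 s.
rewrite inE; case: ifPn => // gx; rewrite -ltNge in gx.
have y0 : y 0 s != 0 by rewrite gt_eqF // (lt_le_trans gx).
by move/eqP: yz; rewrite mulf_eq0 (negbTE y0) /= => /eqP ->.
Qed.

(** For each s, one of the positive part of g_s(x) and the indicator of
    g_s(x) <= 0 vanishes, which gives complementarity; the indicators add up to
    the number of satisfied scenarios. *)
Lemma Xhat_lift (R : realType) (d S m : nat) (X : set 'rV[R]_d)
    (g : 'I_S -> 'rV[R]_d -> R) (x : 'rV[R]_d) :
  (m < S)%N -> Xhat m X g x ->
  Omega m X g (x, \row_s Num.max 0 (g s x), \row_s (g s x <= 0)%R%:R).
Proof.
move=> mS /XhatP - /(_ mS)[Xx cardx]; split => //.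
- by move=> s; rewrite mxE le_max lexx.
- split=> [s|]; first by rewrite mxE ler0n lern1 leq_b1.
  rewrite -natrB ?(ltnW mS) //.
  have -> : \sum_s (\row_s (g s x <= 0)%R%:R : 'rV[R]_S) 0 s =
            #|[pred s | (g s x <= 0)%R]|%:R.
    rewrite -sum1_card natr_sum [RHS]big_mkcond /=; apply: eq_bigr => s _.
    by rewrite mxE inE; case: ifP.
  by rewrite ler_nat.
- move=> s; rewrite !mxE le_max lexx orbT; split=> //.
  by case: leP; rewrite ?mulr0 ?mul0r.
Qed.

Lemma enorm_le_enorm3 (R : realType) (d n k : nat)
    (p : 'rV[R]_d * 'rV[R]_n * 'rV[R]_k) : enorm p.1.1 <= enorm3 p.
Proof.
rewrite -[enorm p.1.1]ger0_norm ?sqrtr_ge0 // -sqrtr_sqr ler_wsqrtr //.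
by rewrite -addrA lerDl addr_ge0 ?sqr_ge0.
Qed.

Theorem theorem4p1 (R : realType) (d S I : nat)
  (S_gt0 : (0 < S)%N) (I_gt0 : (0 < I)%N)
  (alpha : R) (alpha01 : 0 < alpha < 1)
  (m : nat) (m_def : m%:Z = Num.floor (alpha * S%:R))
  (X U : set 'rV[R]_d)
  (X_compact : compact X) (X_convex : convex_set X)
  (X_relint : relative_interior X !=set0)
  (U_open : open U) (XU : X `<=` U)
  (f : 'rV[R]_d -> R)
  (f_C1 : continuously_differentiable_on U f) (f_convex : convex_on U f)
  (h : 'I_S -> 'I_I -> 'rV[R]_d -> R)
  (h_C1 : forall s i, continuously_differentiable_on setT (h s i))
  (h_convex : forall s i, convex_on setT (h s i))
  (xbar : 'rV[R]_d) :
  let g := scenario_max I_gt0 h in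
  local_minimizer (@enorm R d) (Xhat m X g) f xbar ->
  exists (ybar zbar : 'rV[R]_S),
    [/\ nonneg_orthant S ybar, Cset S m zbar &
        local_minimizer (@enorm3 R d S S) (Omega m X g)
          (fun p => f p.1.1) (xbar, ybar, zbar)].
Proof.
move=> g [xbar_in [e e0 xbar_min]].
have mS : (m < S)%N.
  rewrite -(ltr_nat R).
  have : (m%:Z)%:~R <= alpha * S%:R by rewrite m_def ge_floor.
  move/le_lt_trans; apply.
  by rewrite gtr_pMl ?ltr0n //; case/andP: alpha01.
have lift := Xhat_lift mS xbar_in; have [_ y0 zC _] := lift.
exists (\row_s Num.max 0 (g s xbar)), (\row_s (g s xbar <= 0)%R%:R); split=> //.
split=> //; exists e => // -[[x y] z] xyz dist; apply: xbar_min.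
  exact: Omega_Xhat xyz.
exact: le_lt_trans (enorm_le_enorm3 _) dist.
Qed.
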